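(* Fix $a>0$. Let $p_1,\dots,p_n$ be p-values for hypotheses $H_1,\dots,H_n$ with set of nulls $\mathcal H_0\subseteq[n]$, and assume that the null p-values $(p_j)_{j\in\mathcal H_0}$ are independent and stochastically larger than uniform, i.e. $\Pr\{p_j\le s\}\le s$ for all $j\in\mathcal H_0$, $s\in[0,1]$. Let $\pi$ be a fixed-in-advance (nonrandom) ordering of $[n]$, and for a cutoff $p_*\in(0,1]$ let $$\mathcal R_k\equiv\{\pi(j): j\le k,\ p_{\pi(j)}\le p_*\},\qquad k\in[n].$$ 1. Set $p_*=1$, let $h$ be a (possibly unbounded) accumulation function, and for $\alpha\in(0,1)$ define $$\overline V^{h}_{\text{preorder-acc}}(\mathcal R_k)\equiv\left\lfloor\frac{\log(\frac1\alpha)}{a\log\left(\left(\int_0^1\alpha^{h(u)/a}\,du\right)^{-1}\right)}\cdot\left(a+\sum_{j=1}^k h(p_{\pi(j)})\right)\right\rfloor,\qquad \overline{\mathrm{FDP}}^{h}_{\text{preorder-acc}}(\mathcal R_k)\equiv\frac{\overline V^{h}_{\text{preorder-acc}}(\mathcal R_k)}{|\mathcal R_k|}.$$ Then for all $\alpha\in(0,1)$, $$\Pr\left\{\mathrm{FDP}(\mathcal R_k)\le\overline{\mathrm{FDP}}^{h}_{\text{preorder-acc}}(\mathcal R_k)\ \text{for all }k\in[n]\right\}\ge1-\alpha.$$ Moreover, if $\sup_{u\in[0,1]}h(u)\equiv B<\infty$, then the same conclusion holds with $\overline V^{h}_{\text{preorder-acc}}$ replaced by $$\overline V^{B}_{\text{preorder-acc}}(\mathcal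 R_k)\equiv\left\lfloor\frac{\log(\frac1\alpha)}{a\log\left(\left(1-\frac{1-\alpha^{B/a}}{B}\right)^{-1}\right)}\cdot\left(a+\sum_{j=1}^k h(p_{\pi(j)})\right)\right\rfloor.$$ 2. Let $p_*\in(0,1)$, fix $\lambda$ with $p_*\le\lambda<1$, let $B\equiv\frac{p_*}{1-\lambda}$, and for $\alpha\in(0,1)$ define $$\overline V^{B}_{\text{preorder-sel}}(\mathcal R_k)\equiv\left\lfloor\frac{\log(\frac1\alpha)}{a\log\left(1+\frac{1-\alpha^{B/a}}{B}\right)}\cdot\left(a+\sum_{j=1}^k\frac{p_*}{1-\lambda}I(p_{\pi(j)}>\lambda)\right)\right\rfloor,\qquad \overline{\mathrm{FDP}}^{B}_{\text{preorder-sel}}(\mathcal R_k)\equiv\frac{\overline V^{B}_{\text{preorder-sel}}(\mathcal R_k)}{|\mathcal R_k|}.$$ Then for all $\alpha\in(0,1)$, $$\Pr\left\{\mathrm{FDP}(\mathcal R_k)\le\overline{\mathrm{FDP}}^{B}_{\text{preorder-sel}}(\mathcal R_k)\ \text{for all }k\in[n]\right\}\ge1-\alpha.$$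
   Context: $[n]=\{1,\dots,n\}$; an ordering is a permutation $\pi(1),\dots,\pi(n)$ of $[n]$. The p-values are $[0,1]$-valued random variables and $\mathcal H_0$ is a fixed (nonrandom) set. For $\mathcal R\subseteq[n]$, $\mathrm{FDP}(\mathcal R)\equiv|\mathcal R\cap\mathcal H_0|/|\mathcal R|$, with $\mathrm{FDP}(\varnothing)\equiv0$; when $\mathcal R_k=\varnothing$ the inequality $\mathrm{FDP}(\mathcal R_k)\le\overline{\mathrm{FDP}}(\mathcal R_k)$ is regarded as holding trivially. An accumulation function is a function $h:[0,1]\to[0,\infty)$ that is non-decreasing and satisfies $\int_0^1h(u)\,du=1$. $I(\cdot)$ is the indicator, $\lfloor\cdot\rfloor$ the floor function, $\log$ the natural logarithm. *)

(* Defs.v *)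
From HB Require Import structures.
From mathcomp Require Export all_boot all_order all_algebra all_fingroup.
From mathcomp Require Export all_classical all_reals all_analysis.
Set Implicit Arguments.
Unset Strict Implicit.
Unset Printing Implicit Defensive.
Export Order.TTheory GRing.Theory Num.Theory.
Export numFieldNormedType.Exports.
Local Open Scope classical_set_scope.
Local Open Scope ring_scope.

(* The hypotheses 1, ..., n are the elements 0, ..., n-1 of 'I_n, and an
   ordering of them is a permutation pi : 'S_n.  A cutoff position k : 'I_n
   stands for the position k + 1, so that "the first k positions" are the
   j : 'I_n with (j <= k)%N. *)

(* The product rule over every subfamily (J, A i) with J \subset H0. *)
Definition mutually_independent (d : measure_display) (T : measurableType d)
    (R : realType) (P : probability T R) (n : nat) (H0 : {set 'I_n})
    (p : 'I_n -> {RV P >-> R}) : Prop :=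
  forall (J : {set 'I_n}) (A : 'I_n -> set R),
    J \subset H0 -> (forall i, i \in J -> measurable (A i)) ->
    P (\bigcap_(i in [set` J]) (p i @^-1` A i)) =
    (\prod_(i in J) P (p i @^-1` A i))%E.

(* P{X <= s} <= s for every s in [0, 1]. *)
Definition stochastically_larger_than_uniform (d : measure_display)
    (T : measurableType d) (R : realType) (P : probability T R)
    (X : {RV P >-> R}) : Prop :=
  forall s : R, 0 <= s <= 1 -> (P [set t | (X t <= s)%R] <= s%:E)%E.

(* The values are extended reals so as to include the unbounded functions,
   such as u |-> ln (1 / (1 - u)): a non-decreasing function that is real
   valued on all of [0, 1] is bounded by its value at 1.  The integral forces
   h to be finite on [0, 1[, so that +oo is only possible at 1.  Only the
   restriction of h to [0, 1] matters. *)
Record accumulation (R : realType) (h : R -> \bar R) : Prop := Accumulation {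
  accumulation_ge0 : forall u : R, 0 <= u <= 1 -> (0 <= h u)%E ;
  accumulation_nondecreasing :
    forall u v : R, 0 <= u -> u <= v -> v <= 1 -> (h u <= h v)%E ;
  accumulation_int1 :
    (\int[lebesgue_measure]_(u in `[0%R, 1%R]) h u = 1)%E }.

(* b ^ x for 0 < b < 1 and x in [0, +oo], with b ^ +oo = 0; the value at -oo
   is irrelevant. *)
Definition pow_ereal (R : realType) (b : R) (x : \bar R) : R :=
  if x is r%:E then b `^ r else 0.

Definition efloor (R : realType) (x : \bar R) : \bar R :=
  if x is r%:E then ((Num.floor r)%:~R : R)%:E else x.

Definition sel (R : realType) (n : nat) (pi : 'S_n) (pstar : R)
    (x : 'I_n -> R) (k : 'I_n) : {set 'I_n} :=
  [set pi j | j in [pred j : 'I_n | (j <= k)%N && (x (pi j) <= pstar)]]%SET.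

(* The value at the empty set is 0, since 0 / 0 = 0. *)
Definition FDP (R : realType) (n : nat) (H0 Rk : {set 'I_n}) : R :=
  #|Rk :&: H0|%:R / #|Rk|%:R.

Definition FDPbar (R : realType) (n : nat) (V : \bar R) (Rk : {set 'I_n})
  : \bar R := (V * (#|Rk|%:R^-1)%:E)%E.

(* For all k, FDP(R_k) <= V_k / |R_k|, which holds by convention when R_k is
   empty; x is the vector of p-values and V x k is the bound V_k. *)
Definition simultaneous_bound (R : realType) (n : nat) (H0 : {set 'I_n})
    (pi : 'S_n) (pstar : R) (V : ('I_n -> R) -> 'I_n -> \bar R)
    (x : 'I_n -> R) : Prop :=
  forall k : 'I_n, let Rk := sel pi pstar x k in
    Rk = finset.set0 \/ ((FDP R H0 Rk)%:E <= FDPbar (V x k) Rk)%E.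

Definition V_preorder_acc (R : realType) (n : nat) (a alpha : R) (pi : 'S_n)
    (h : R -> \bar R) (x : 'I_n -> R) (k : 'I_n) : \bar R :=
  let I := \int[lebesgue_measure]_(u in `[0, 1])
             pow_ereal alpha (h u * (a^-1)%:E)%E in
  efloor ((ln (1 / alpha) / (a * ln (I^-1)))%:E *
          (a%:E + \sum_(j < n | (j <= k)%N) h (x (pi j))))%E.

Definition V_preorder_acc_bounded (R : realType) (n : nat) (a alpha B : R)
    (pi : 'S_n) (h : R -> \bar R) (x : 'I_n -> R) (k : 'I_n) : \bar R :=
  efloor ((ln (1 / alpha) /
           (a * ln ((1 - (1 - alpha `^ (B / a)) / B)^-1)))%:E *
          (a%:E + \sum_(j < n | (j <= k)%N) h (x (pi j))))%E.

Definition V_preorder_sel (R : realType) (n : nat) (a alpha pstar lambda : R)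
    (pi : 'S_n) (x : 'I_n -> R) (k : 'I_n) : \bar R :=
  let B := pstar / (1 - lambda) in
  ((Num.floor (ln (1 / alpha) / (a * ln (1 + (1 - alpha `^ (B / a)) / B)) *
     (a + \sum_(j < n | (j <= k)%N)
            pstar / (1 - lambda) * (lambda < x (pi j))%R%:R)))%:~R : R)%:E.

(* Main.v *)
Require Import Defs.
From mathcomp Require Import measurable_realfun.
From mathcomp Require Import ring lra.
Local Open Scope classical_set_scope.
Local Open Scope ring_scope.

(** All three bounds are instances of one maximal inequality.  Give each
    position a factor: a hypothesis i with p-value u contributes
    alpha ^ (h u / a), multiplied by exp L when i is null and u <= pstar.
    Unfolding the floor and the logarithms, the bound
      V_k = floor (ln (1/alpha) / (a L) * (a + sum of the scores up to k))
    is at least the number of false discoveries among the first k positions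
    exactly when the product of the first k factors is at most 1 / alpha
    ([le_efloorE], [simultaneous_boundE]).  A factor of a non-null is at most
    1, so the product is dominated by the product over the nulls alone; there
    the factors are independent, and once their expectations are at most 1 the
    products form a nonnegative supermartingale started at 1.  By Ville's
    inequality ([ville]) it ever exceeds 1 / alpha with probability at most
    alpha.  This is [simultaneous_bound_prob]; what is left in each case is to
    see that L makes the expectation of a null factor at most 1.

    For an accumulation function, u |-> alpha ^ (h u / a) is nonincreasing,
    so its expectation under a law larger than uniform is at most its integral
    I over [0, 1] ([le_expectation_uniform]), and L = ln (1 / I) will do, as
    will L = ln (1 / c) for any c in ]0, 1[ above I.  When h <= B, the chord of
    the convex function x |-> alpha ^ (x / a) between 0 and B together with
    the normalization of h gives c = 1 - (1 - alpha ^ (B / a)) / B.  For the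
    selective procedure the factor takes three values, and it is a
    constant plus nonnegative multiples of the indicators of u <= lambda and
    u <= pstar, whose expectations are bounded by lambda and pstar; the
    constants are tuned so that these bounds add up to 1
    ([integral_sel_wealth]).

    Ville's inequality is derived from the product rule for events only.
    For factors with finitely many values, conditioning on the value of the
    first factor turns the event for the threshold c into the event for the
    remaining factors and the threshold c / v, on a smaller cylinder; summing
    over v reproduces the expectation of the first factor ([ville_nnsfun]).
    The general case follows by monotone approximation from below, the strict
    inequality in the event making it an increasing union. *)

Set Implicit Arguments.
Unset Strict Implicit.
Unset Printing Implicit Defensive.
Import HBNNSimple.

(** * Running maxima of products *)

Lemma measurable_gt d (T : measurableType d) (R : realType) (X : T -> R)
    (b : R) :
  measurable_fun setT X -> measurable [set t | b < X t].
Proof.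
move=> mX; rewrite -(preimage_itvoy X b) -[X in measurable X]setTI.
by apply: mX => //; exact: measurable_itv.
Qed.

(** This is the maximum of the prefix products 1, x1, x1 x2, ... of nonnegative
    factors, written in Horner form so that an induction can peel off the
    first factor. *)
Definition running_max (R : realType) (xs : seq R) : R :=
  foldr (fun x m => Num.max 1 (x * m)) 1 xs.

Lemma running_max_ge1 (R : realType) (xs : seq R) : 1 <= running_max xs.
Proof. by case: xs => //= x xs; rewrite le_max lexx. Qed.

(** The factors outside Q are skipped on both sides, hence a prefix of s gives a
    prefix of the filtered sequence, of some other length. *)
Lemma prod_prefix_le_running_max (R : realType) (I : Type) (Q : pred I)
    (X : I -> R) (s : seq I) (k : nat) : (forall i, 0 <= X i) ->
  \prod_(i <- take k s | Q i) X i <= running_max [seq X i | i <- s & Q i].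
Proof.
move=> X0; elim: s k => [|i s IH] [|k] /=; rewrite ?big_nil ?running_max_ge1//.
rewrite big_cons; case: ifP => //= _; rewrite le_max; apply/orP; right.
by rewrite ler_wpM2l.
Qed.

Lemma measurable_running_max d (T : measurableType d) (R : realType) (I : Type)
    (X : I -> T -> R) (s : seq I) :
  (forall i, measurable_fun setT (X i)) ->
  measurable_fun setT (fun t => running_max [seq X i t | i <- s]).
Proof.
move=> mX; elim: s => [|i s IH] /=; first exact: measurable_cst.
apply: measurable_maxr; first exact: measurable_cst.
exact: measurable_funM.
Qed.

Lemma running_max_cvg (R : realType) (I : Type) (X : nat -> I -> R) (Y : I -> R)
    (s : seq I) :
  (forall i, X ^~ i @ \oo --> Y i) ->
  (fun m => running_max [seq X m i | i <- s]) @ \oo -->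
  running_max [seq Y i | i <- s].
Proof.
move=> XY; elim: s => [|i s IH] /=; first exact: cvg_cst.
apply: (@continuous2_cvg nat R R R _ _ _ _ Num.max).
- exact: (@max_continuous _ R (1, _)).
- exact: cvg_cst.
- exact: cvgM.
Qed.

Lemma le_running_max (R : realType) (I : Type) (X Y : I -> R) (s : seq I) :
  (forall i, 0 <= X i <= Y i) ->
  running_max [seq X i | i <- s] <= running_max [seq Y i | i <- s].
Proof.
move=> XY; elim: s => //= i s IH; have /andP[Xi0 XYi] := XY i.
rewrite ge_max !le_max lexx/= ler_pM ?orbT//.
exact: le_trans ler01 (running_max_ge1 _).
Qed.

(** * Ville's inequality *)

Section Ville.
Context (d : measure_display) (T : measurableType d) (R : realType)
  (P : probability T R) (n : nat) (H0 : {set 'I_n}) (p : 'I_n -> {RV P >-> R}).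
Hypothesis indep : mutually_independent H0 p.

Definition cylinder (J : {set 'I_n}) (A : 'I_n -> set R) : set T :=
  \bigcap_(i in [set` J]) (p i @^-1` A i).

Lemma measurable_cylinder (J : {set 'I_n}) (A : 'I_n -> set R) :
  (forall i, measurable (A i)) -> measurable (cylinder J A).
Proof.
move=> mA; apply: fin_bigcap_measurable; first exact: finite_finset.
by move=> i _; exact: measurable_funPTI.
Qed.

Lemma cylinder_cons (J : {set 'I_n}) A i B : i \notin J ->
  cylinder (i |: J) (fun j => if j == i then B else A j) =
  cylinder J A `&` (p i @^-1` B).
Proof.
move=> iJ; apply/seteqP; split => t /=.
  move=> c; split; last by have := c i; rewrite /= setU11 eqxx; exact.
  move=> j /= jJ; have := c j; rewrite /= setU1r// => /(_ isT).
  by case: eqP => // ji; rewrite -ji jJ in iJ.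
move=> [c Bi] j /=; case: eqP => [-> //|/eqP ji].
by rewrite !inE (negbTE ji)/= => jJ; exact: c.
Qed.

Lemma prob_cylinder_cons (J : {set 'I_n}) A i B :
  J \subset H0 -> i \in H0 -> i \notin J ->
  (forall j, measurable (A j)) -> measurable B ->
  (P (cylinder J A `&` (p i @^-1` B)) = P (cylinder J A) * P (p i @^-1` B))%E.
Proof.
move=> JH iH iJ mA mB; rewrite -cylinder_cons// /cylinder.
rewrite !indep//; first last.
- by move=> j _; case: ifP.
- apply/fintype.subsetP => j.
  by rewrite !inE => /predU1P[->|/(fintype.subsetP JH)].
rewrite big_setU1//= eqxx muleC; congr (_ * _)%E.
by apply: eq_bigr => j jJ; case: eqP => // ji; rewrite -ji jJ in iJ.
Qed.

Lemma expectation_nnsfun (g : {nnsfun R >-> R}) i :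
  (\int[P]_t (g (p i t))%:E =
   \sum_(v \in range g) v%:E * P (p i @^-1` (g @^-1` [set v])))%E.
Proof.
have mg : measurable_fun setT (fun x => (g x)%:E) by exact/measurable_EFinP.
rewrite -[LHS](ge0_integral_distribution (p i) mg); last first.
  by move=> y; rewrite lee_fin.
by rewrite integralT_nnsfun sintegralE.
Qed.

(** The cylinder over indices J outside s is what makes the induction on s
    work: fixing the value v of the first factor is one more constraint on the
    cylinder, whose probability factors by independence, and the threshold for
    the remaining factors becomes c / v.  Summing v times the probability of
    the value v gives the expectation of the first factor, which is at most
    1. *)
Lemma ville_nnsfun (g : 'I_n -> {nnsfun R >-> R}) (s : seq 'I_n)
    (J : {set 'I_n}) (A : 'I_n -> set R) (c : R) :
  uniq s -> {subset s <= H0} -> J \subset H0 -> {in s, forall i, i \notin J} ->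
  (forall i, measurable (A i)) ->
  (forall i, i \in s -> \int[P]_t (g i (p i t))%:E <= 1)%E -> 0 < c ->
  (c%:E * P (cylinder J A `&`
      [set t | (c < running_max [seq g i (p i t) | i <- s])%R]) <=
   P (cylinder J A))%E.
Proof.
elim: s J A c => [|i s IH] J A c.
- move=> _ _ JH _ mA _ c0 /=.
  have mE : measurable (cylinder J A) by exact: measurable_cylinder.
  have [c1|c1] := ltP c 1; last first.
    rewrite (_ : [set _ | _] = set0) ?setI0 ?measure0 ?mule0//.
    by apply/seteqP; split => // t /=; rewrite ltNge c1.
  rewrite (_ : [set _ | _] = setT) ?setIT; last exact/seteqP.
  by rewrite -[leRHS]mul1e lee_wpmul2r// lee_fin ltW.
move=> /= /andP[is_ us] sH JH sJ mA gE c0.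
have mE : measurable (cylinder J A) by exact: measurable_cylinder.
have mM (r : seq 'I_n) (b : R) :
    measurable [set t | b < running_max [seq g i (p i t) | i <- r]].
  apply: measurable_gt; apply: measurable_running_max => j.
  exact: measurableT_comp.
have [c1|c1] := ltP c 1.
  rewrite -[leRHS]mul1e lee_pmul//; first by rewrite lee_fin ltW.
    by rewrite lee_fin ltW.
  apply: le_measure; rewrite ?inE//.
  by apply: measurableI => //; exact: (mM (i :: s)).
(* From here on 1 <= c: the maximum exceeds c only beyond the empty prefix. *)
have iH : i \in H0 by apply: sH; rewrite mem_head.
have iJ : i \notin J by apply: sJ; rewrite mem_head.
pose B v := g i @^-1` [set v].
have mB v : measurable (B v) by exact: measurable_funPTI.
pose F v := (cylinder J A `&` p i @^-1` (B v)) `&`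
   [set t | c < v * running_max [seq g i (p i t) | i <- s]].
have mEB v : measurable (cylinder J A `&` p i @^-1` (B v)).
  by apply: measurableI => //; exact: (measurable_funPTI (p i) (mB v)).
have mF v : measurable (F v).
  apply: measurableI => //; apply: measurable_gt.
  apply: measurable_funM; first exact: measurable_cst.
  by apply: measurable_running_max => j; exact: measurableT_comp.
have cF v : range (g i) v -> (c%:E * P (F v) <=
    P (cylinder J A) * (v%:E * P (p i @^-1` (B v))))%E.
  move=> [x _ gxv]; have : 0 <= v by rewrite -gxv.
  rewrite le_eqVlt => /predU1P[<-|v0].
    rewrite mul0e mule0 /F (_ : [set _ | _] = set0) ?setI0 ?measure0 ?mule0//.
    by apply/seteqP; split => // t /=; rewrite mul0r ltNge ltW.
  have := IH (i |: J) (fun j => if j == i then B v else A j) (c / v).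
  rewrite cylinder_cons// prob_cylinder_cons// => /(_ us) H.
  have {H} : ((c / v)%:E * P (F v) <= P (cylinder J A) * P (p i @^-1` B v))%E.
    rewrite /F (_ : [set t | c < v * _] = [set t | c / v <
        running_max [seq g i (p i t) | i <- s]]).
      apply: H.
      - by move=> j js; apply: sH; rewrite inE js orbT.
      - apply/fintype.subsetP => j.
        by rewrite !inE => /predU1P[->|/(fintype.subsetP JH)].
      - move=> j js; rewrite !inE negb_or sJ ?inE ?js ?orbT// andbT.
        by apply: contraNneq is_ => <-.
      - by move=> j; case: ifP => _; [exact: (mB v)|exact: mA].
      - by move=> j js; apply: gE; rewrite inE js orbT.
      - exact: divr_gt0.
    by apply/seteqP; split => t /=; rewrite ltr_pdivrMr// mulrC.
  have v0' : (0 <= v%:E)%E by rewrite lee_fin ltW.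
  move=> /(lee_wpmul2l v0'); rewrite muleA -EFinM mulrCA divff ?gt_eqF// mulr1.
  by rewrite muleCA.
apply: (@le_trans _ _ (\sum_(v \in range (g i)) (c%:E * P (F v)))%E).
  rewrite -ge0_mule_fsumr//; apply: lee_wpmul2l; first by rewrite lee_fin ltW.
  apply: content_sub_fsum => //.
    by apply: measurableI => //; exact: (mM (i :: s)).
  move=> t [Et /=]; rewrite lt_max ltNge c1/= => ct.
  by exists (g i (p i t)); [exists (p i t)|].
apply: (@le_trans _ _ (\sum_(v \in range (g i))
    (P (cylinder J A) * (v%:E * P (p i @^-1` (B v)))))%E).
  by apply: lee_fsum.
have ge0F v : (0 <= v%:E * P (p i @^-1` (B v)))%E.
  have [v0|v0] := leP 0 v; first by rewrite mule_ge0// lee_fin.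
  rewrite /B (_ : g i @^-1` _ = set0) ?preimage_set0 ?measure0 ?mule0//.
  apply/seteqP; split => // x /= gx.
  by have : 0 <= g i x by []; rewrite gx leNgt v0.
rewrite -ge0_mule_fsumr// -[leRHS]mule1 lee_wpmul2l//.
by rewrite -expectation_nnsfun gE// mem_head.
Qed.

(** The simple functions g m increase to f, and their expectations stay below
    those of f.  Continuity of the running maximum and the strict inequality
    make the event for f the increasing union of the events for the g m, so
    that the bound passes to the limit. *)
Lemma ville (f : 'I_n -> R -> R) (s : seq 'I_n) (c : R) :
  uniq s -> {subset s <= H0} -> (forall i, measurable_fun setT (f i)) ->
  (forall i x, 0 <= f i x) ->
  (forall i, i \in s -> \int[P]_t (f i (p i t))%:E <= 1)%E -> 0 < c ->
  (P [set t | (c < running_max [seq f i (p i t) | i <- s])%R] <= (c^-1)%:E)%E.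
Proof.
move=> us sH mf f0 fE c0.
have mfE i : measurable_fun setT (fun x => (f i x)%:E).
  exact/measurable_EFinP.
pose g m i := nnsfun_approx measurableT (mfE i) m.
have g_nd i x : {homo (fun m => g m i x) : m m' / (m <= m')%N >-> m <= m'}.
  by move=> m m' mm'; exact/lefP/nd_nnsfun_approx.
have g_cvg i (x : R) : (fun m => g m i x) @ \oo --> f i x.
  have : EFin \o (fun m => g m i x) @ \oo --> (f i x)%:E.
    by apply: cvg_nnsfun_approx => // y _; rewrite lee_fin.
  exact: fine_cvg.
have g_le m i x : g m i x <= f i x.
  rewrite -(cvg_lim _ (g_cvg i x))//; apply: nondecreasing_cvgn_le => //.
  by apply/cvg_ex; exists (f i x).
pose E m := [set t | c < running_max [seq g m i (p i t) | i <- s]].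
have mE m : measurable (E m).
  apply: measurable_gt; apply: measurable_running_max => i.
  exact: measurableT_comp.
have PE m : (P (E m) <= (c^-1)%:E)%E.
  have := @ville_nnsfun (g m) s finset.set0 (fun=> setT) c us sH
    (finset.sub0set _).
  rewrite /cylinder (_ : \bigcap_(_ in _) _ = setT); last first.
    by apply/seteqP; split => // t _ i /=; rewrite inE.
  rewrite setTI probability_setT -[(c^-1)%:E]mule1 lee_pdivlMl//; apply => //.
  - by move=> i _; rewrite inE.
  - move=> i /fE; apply: le_trans; apply: ge0_le_integral => //.
    + by move=> t _; rewrite lee_fin.
    + by apply/measurable_EFinP; exact: measurableT_comp.
    + by apply/measurable_EFinP; exact: measurableT_comp.
    + by move=> t _; rewrite lee_fin.
have -> : [set t | c < running_max [seq f i (p i t) | i <- s]] = \bigcup_m E m.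
  apply/seteqP; split => t /=.
    move=> cf.
    have := @running_max_cvg _ _ (fun m i => g m i (p i t)) _ s
      (fun i => g_cvg i (p i t)).
    by move=> /cvgr_gt /(_ _ cf) [m _ /(_ m (leqnn m))]; exists m.
  move=> [m _] /= cE; apply: lt_le_trans cE _.
  by apply: le_running_max => i; rewrite fun_ge0 g_le.
have cvgPE : P \o E @ \oo --> P (\bigcup_m E m).
  apply: (@nondecreasing_cvg_mu _ _ _ P) => //; first exact: bigcup_measurable.
  move=> m m' mm'; apply/subsetPset => t /= cE; apply: lt_le_trans cE _.
  by apply: le_running_max => i; rewrite fun_ge0 g_nd.
apply: cvge_le cvgPE; near=> m; exact: PE.
Unshelve. all: end_near. Qed.

End Ville.

(** * Expectations under a law larger than uniform *)

Lemma integral_tail d (T : measurableType d) (R : realType)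
    (P : probability T R) (f : T -> R) :
  measurable_fun setT f -> (forall t, 0 <= f t) ->
  (\int[P]_t (f t)%:E =
   \int[lebesgue_measure]_(r in `[0%R, +oo[) P [set t | (r < f t)%R])%E.
Proof.
move=> mf f0; pose X : {RV P >-> R} := mfun_Sub (mem_set mf).
rewrite -[LHS](expectation_def X) ge0_expectation_ccdf//.
apply: eq_integral => r _.
by rewrite /ccdf /distribution /pushforward preimage_itvoy.
Qed.

Lemma measurable_tail d (T : measurableType d) (R : realType)
    (P : probability T R) (f : T -> R) :
  measurable_fun setT f ->
  measurable_fun setT (fun r : R => P [set t | (r < f t)%R]).
Proof.
move=> mf; pose X : {RV P >-> R} := mfun_Sub (mem_set mf).
rewrite [X in measurable_fun _ X](_ : _ = ccdf X); first exact: ccdf_measurable.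
apply/funext => r.
by rewrite /ccdf /distribution /pushforward preimage_itvoy.
Qed.

Section StochasticOrder.
Context (d : measure_display) (T : measurableType d) (R : realType)
  (P : probability T R).

(** The superlevel set of g in [0, 1] is an initial interval, with or without
    its end point s: it contains [0, s[, of measure s, and X falls in it only
    if X <= s, an event of probability at most s. *)
Lemma le_prob_uniform (X : {RV P >-> R}) (g : R -> R) (r : R) :
  (forall t, 0 <= X t <= 1) -> stochastically_larger_than_uniform X ->
  nonincreasing_fun g ->
  (P [set t | (r < g (X t))%R] <=
   lebesgue_measure [set u : R | ((0 <= u <= 1) && (r < g u))%R])%E.
Proof.
move=> X01 sX g_ni.
have mg : measurable_fun setT g.
  exact: (nonincreasing_measurable measurableT).
pose D := [set u : R | (0 <= u <= 1) && (r < g u)].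
have mD : measurable D.
  rewrite (_ : D = `[0, 1] `&` [set u | r < g u]).
    by apply: measurableI; [exact: measurable_itv|exact: measurable_gt].
  by apply/seteqP; split=> u; rewrite /D/= in_itv/= => /andP.
have mE : measurable [set t | r < g (X t)].
  by apply: (@measurable_gt _ _ _ (g \o X)); apply: measurableT_comp.
have [D0|/set0P D0] := eqVneq D set0.
  rewrite (_ : [set t | _] = set0) ?measure0//.
  apply/seteqP; split => // t /= rg; have : D (X t) by rewrite /D/= X01 rg.
  by rewrite D0.
have Dsup : has_sup D.
  by split=> //; exists 1 => u /= /andP[/andP[]].
have sD01 : 0 <= sup D <= 1.
  case: D0 => u Du; have /= /andP[/andP[u0 u1] _] := Du.
  rewrite (le_trans u0) ?ub_le_sup//; last by case: Dsup.
  by apply: ge_sup => [|v /= /andP[/andP[]]]; first by exists u.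
apply: (@le_trans _ _ (P [set t | (X t <= sup D)%R])).
  apply: le_measure; rewrite ?inE//.
    rewrite -[X in measurable X]setTI -preimage_itvNyc.
    by apply: measurable_funPT => //; exact: measurable_itv.
  move=> t /= rg; apply: ub_le_sup; first by case: Dsup.
  by rewrite /D/= rg andbT; exact: X01.
apply: le_trans (sX _ sD01) _.
have -> : ((sup D)%:E = lebesgue_measure `[0%R, sup D[)%E.
  rewrite lebesgue_measure_itv/= lte_fin sube0; case: ltP => // sD0.
  by congr EFin; apply/eqP; rewrite eq_le sD0; case/andP: sD01.
apply: le_measure; rewrite ?inE//.
move=> u /=; rewrite in_itv/= => /andP[u0 uD].
have uD0 : 0 < sup D - u by rewrite subr_gt0.
have [v /= /andP[/andP[v0 v1] rv]] := sup_adherent uD0 Dsup.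
rewrite subKr => uv; rewrite u0 (le_trans (ltW uv) v1)/=.
exact: lt_le_trans rv (g_ni _ _ (ltW uv)).
Qed.

(** Both integrals are integrals of tail probabilities, which are compared level
    by level; the right-hand side is read as an expectation under the uniform
    law. *)
Lemma le_expectation_uniform (X : {RV P >-> R}) (g : R -> R) :
  (forall t, 0 <= X t <= 1) -> stochastically_larger_than_uniform X ->
  (forall x, 0 <= g x) -> nonincreasing_fun g ->
  (\int[P]_t (g (X t))%:E <=
   \int[lebesgue_measure]_(u in `[0%R, 1%R]) (g u)%:E)%E.
Proof.
move=> X01 sX g0 g_ni.
have mg : measurable_fun setT g.
  exact: (nonincreasing_measurable measurableT).
have mgX : measurable_fun setT (g \o X) by exact: measurableT_comp.
pose U : probability (measurableTypeR R) R := uniform_prob (@ltr01 R).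
have mg' : @measurable_fun _ _ (measurableTypeR R) (measurableTypeR R) setT g.
  exact: mg.
have := integral_tail U mg' g0; rewrite {1}/U integral_uniform/=; first last.
- by move=> x; rewrite lee_fin.
- exact/measurable_EFinP.
rewrite subr0 invr1 mul1e => ->.
rewrite (integral_tail P mgX (fun t => g0 (X t))).
apply: ge0_le_integral => //=.
- by apply: measurable_funTS; exact: (measurable_tail P mgX).
- by apply: measurable_funTS; exact: (measurable_tail U mg').
move=> r _; apply: le_trans (le_prob_uniform r X01 sX g_ni) _.
rewrite /U /uniform_prob/= integral_uniform_pdf.
rewrite (eq_integral (cst 1%E)); last first.
  move=> u; rewrite inE => -[_ /=]; rewrite in_itv/= => u01.
  by rewrite /uniform_pdf u01 subr0 invr1.
rewrite integral_cst//=; last first.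
  by apply: measurableI; [exact: measurable_gt|exact: measurable_itv].
rewrite mul1e (_ : [set u | _] = [set t : R | r < g t] `&` `[0, 1])//.
apply/seteqP; split=> u; rewrite /= in_itv/=.
  by move=> /andP[].
by move=> [-> ->].
Qed.

End StochasticOrder.

(** * From the floor bound to a product *)

Section PowEreal.
Context (R : realType) (alpha : R).
Hypothesis alpha01 : 0 < alpha < 1.

Lemma alpha_gt0 : 0 < alpha. Proof. by case/andP: alpha01. Qed.
Lemma ln_alpha_lt0 : ln alpha < 0.
Proof. by apply: ln_lt0. Qed.

Lemma powR_alpha r : alpha `^ r = expR (r * ln alpha).
Proof. by rewrite /powR gt_eqF// alpha_gt0. Qed.

Lemma pow_ereal_ge0 x : 0 <= pow_ereal alpha x.
Proof. by case: x => [r| |] //=; exact: powR_ge0. Qed.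

Lemma pow_ereal_le x y :
  (0 <= x)%E -> (x <= y)%E -> pow_ereal alpha y <= pow_ereal alpha x.
Proof.
move: x y => [x| |] [y| |] //=; last by move=> *; exact: powR_ge0.
rewrite !lee_fin => _ xy.
by rewrite !powR_alpha ler_expR ler_wnM2r// ltW// ln_alpha_lt0.
Qed.

Lemma pow_ereal_le1 x : (0 <= x)%E -> pow_ereal alpha x <= 1.
Proof.
move=> x0; have := pow_ereal_le (lexx 0%E) x0.
by rewrite /= powRr0.
Qed.

Lemma pow_erealD x y : (0 <= x)%E -> (0 <= y)%E ->
  pow_ereal alpha (x + y) = pow_ereal alpha x * pow_ereal alpha y.
Proof.
move: x y => [x| |] [y| |] //= _ _; rewrite ?mul0r ?mulr0//.
by rewrite powRD ?(gt_eqF alpha_gt0) ?implybT.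
Qed.

Lemma pow_ereal_sum (a : R) (I : Type) (s : seq I) (Q : pred I)
    (F : I -> \bar R) :
  0 < a -> (forall i, Q i -> (0 <= F i)%E) ->
  pow_ereal alpha ((\sum_(i <- s | Q i) F i) * (a^-1)%:E)%E =
  \prod_(i <- s | Q i) pow_ereal alpha (F i * (a^-1)%:E)%E.
Proof.
move=> a0 F0; have ai0 : (0 <= (a^-1)%:E)%E by rewrite lee_fin invr_ge0 ltW.
elim: s => [|i s IH]; first by rewrite !big_nil mul0e /= powRr0.
rewrite !big_cons; case: ifP => // Qi.
rewrite ge0_muleDl ?F0//; last by apply: sume_ge0.
by rewrite pow_erealD ?IH// mule_ge0 ?F0// sume_ge0.
Qed.

(** An integer is below a floor iff it is below the real number, so the left
    side reads L m <= ln (1/alpha) (1 + x / a); exponentiate.  For x = +oo both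
    sides hold, the power being 0. *)
Lemma le_efloorE (a L : R) (m : nat) (x : \bar R) :
  0 < a -> 0 < L -> (0 <= x)%E ->
  (m%:R%:E <= efloor ((ln (1 / alpha) / (a * L))%:E * (a%:E + x)))%E =
  (expR (L * m%:R) * pow_ereal alpha (x * (a^-1)%:E)%E <= 1 / alpha).
Proof.
move=> a0 L0; have l0 := ln_alpha_lt0; have al0 := alpha_gt0.
have lnV : ln (1 / alpha) = - ln alpha by rewrite div1r lnV.
have c0 : 0 < ln (1 / alpha) / (a * L).
  by rewrite lnV divr_gt0 ?oppr_gt0// mulr_gt0.
case: x => [x| |]// x0; last first.
  rewrite addey// gt0_muley ?lte_fin//= leey.
  by rewrite gt0_mulye ?lte_fin ?invr_gt0//= mulr0 divr_ge0// ltW.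
rewrite -EFinD -!EFinM /= lee_fin -[m%:R]/((m : int)%:~R) ler_int.
rewrite floor_ge_int -pmulrn.
rewrite powR_alpha -expRD -[1 / alpha]lnK ?posrE ?divr_gt0// ler_expR lnV.
rewrite mulrAC ler_pdivlMr ?mulr_gt0//.
rewrite -(ler_pM2r a0 (L * _ + _)) mulrDl.
have -> : x * a^-1 * ln alpha * a = x * ln alpha by field; rewrite gt_eqF.
rewrite -[RHS]subr_ge0 -[LHS]subr_ge0; congr (0 <= _).
by rewrite expRK; ring.
Qed.

End PowEreal.

Lemma card_sel_null (R : realType) (n : nat) (H0 : {set 'I_n}) (pi : 'S_n)
    (pstar : R) (x : 'I_n -> R) (k : 'I_n) :
  #|sel pi pstar x k :&: H0| =
  (\sum_(j < n | (j <= k)%N) ((pi j \in H0) && (x (pi j) <= pstar)%R))%N.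
Proof.
have -> : sel pi pstar x k :&: H0 =
    [set pi j | j in [pred j : 'I_n |
       [&& (j <= k)%N, pi j \in H0 & x (pi j) <= pstar]]]%SET.
  apply/setP => i; rewrite !inE; apply/andP/imsetP.
    move=> [/imsetP[j /= + ->]]; rewrite inE => /andP[jk xj] Hj.
    by exists j; rewrite // inE jk Hj.
  move=> [j]; rewrite inE => /and3P[jk Hj xj] ->; split => //.
  by apply/imsetP; exists j; rewrite // inE jk.
rewrite card_imset; last exact: perm_inj.
rewrite -sum1_card big_mkcondr/=.
by apply: eq_bigr => j _; case: ifP.
Qed.

Lemma take_enum_ord (n : nat) (k : 'I_n) :
  take k.+1 (enum 'I_n) = [seq j : 'I_n <- enum 'I_n | (j <= k)%N].
Proof.
apply: (inj_map val_inj); rewrite map_take.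
rewrite -[RHS]/(map val (seq.filter (preim val (leq^~ k)) (enum 'I_n))).
rewrite -filter_map val_enum_ord take_iota (minn_idPl (ltn_ord k)).
by rewrite -(filter_iota_leq 0 (ltn_ord k)).
Qed.

(** * The simultaneous bound for one score function *)

Section Control.
Context (d : measure_display) (T : measurableType d) (R : realType)
  (P : probability T R) (n : nat) (H0 : {set 'I_n}) (pi : 'S_n)
  (p : 'I_n -> {RV P >-> R}) (a alpha L pstar : R)
  (h : R -> \bar R) (g : R -> R) (V : ('I_n -> R) -> 'I_n -> \bar R).
Hypothesis a0 : 0 < a.
Hypothesis alpha01 : 0 < alpha < 1.
Hypothesis L0 : 0 < L.
Hypothesis h0 : forall u, 0 <= u <= 1 -> (0 <= h u)%E.
Hypothesis gE : forall u, 0 <= u <= 1 ->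
  g u = pow_ereal alpha (h u * (a^-1)%:E)%E.
Hypothesis g01 : forall u, 0 <= g u <= 1.
Hypothesis VE : forall x k, (forall i, 0 <= x i <= 1) ->
  V x k = efloor ((ln (1 / alpha) / (a * L))%:E *
                  (a%:E + \sum_(j < n | (j <= k)%N) h (x (pi j))))%E.

(** The factor by which hypothesis i multiplies the supermartingale.  Only the
    values of h on [0, 1] being under control, g stands for a function defined on
    the whole line that agrees with u |-> alpha ^ (h u / a) there. *)
Definition wealth_factor (i : 'I_n) (u : R) : R :=
  (if i \in H0 then expR (L * (u <= pstar)%R%:R) else 1) * g u.

Lemma prod_wealth_factor (x : 'I_n -> R) (k : 'I_n) :
  (forall i, 0 <= x i <= 1) ->
  \prod_(j < n | (j <= k)%N) wealth_factor (pi j) (x (pi j)) =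
  expR (L * #|sel pi pstar x k :&: H0|%:R) *
  pow_ereal alpha ((\sum_(j < n | (j <= k)%N) h (x (pi j))) * (a^-1)%:E)%E.
Proof.
move=> x01; rewrite big_split/=; congr (_ * _); last first.
  rewrite pow_ereal_sum//; last by move=> j _; exact: h0.
  by apply: eq_bigr => j _; rewrite gE.
rewrite card_sel_null natr_sum mulr_sumr expR_sum; apply: eq_bigr => j _.
by case: ifP => //= _; rewrite mulr0 expR0.
Qed.

(** A cutoff at which nothing is selected satisfies the right-hand side as well:
    without a discovery, the product is at most 1. *)
Lemma simultaneous_boundE (x : 'I_n -> R) : (forall i, 0 <= x i <= 1) ->
  simultaneous_bound H0 pi pstar V x <->
  (forall k : 'I_n, \prod_(j < n | (j <= k)%N) wealth_factor (pi j) (x (pi j))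
                    <= 1 / alpha).
Proof.
move=> x01; have sum0 k : (0 <= \sum_(j < n | (j <= k)%N) h (x (pi j)))%E.
  by apply: sume_ge0 => j _; exact: h0.
have al1 : 1 <= 1 / alpha.
  by case/andP: alpha01 => ? /ltW; rewrite div1r invf_ge1.
split=> [Hk k|Hk k /=]; have [Rk0|Rk0] := eqVneq (sel pi pstar x k) finset.set0.
- rewrite prod_wealth_factor// Rk0 finset.set0I cards0 mulr0 expR0 mul1r.
  apply: le_trans al1; rewrite pow_ereal_le1// mule_ge0//.
  by rewrite lee_fin invr_ge0 ltW.
- have [Rk0'|] := Hk k; first by rewrite Rk0' eqxx in Rk0.
  rewrite /FDP /FDPbar EFinM lee_pmul2r//; last first.
    by rewrite lte_fin invr_gt0 ltr0n card_gt0.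
  by rewrite prod_wealth_factor// VE// le_efloorE.
- by left.
- right; rewrite /FDP /FDPbar EFinM lee_pmul2r//; last first.
    by rewrite lte_fin invr_gt0 ltr0n card_gt0.
  by rewrite VE// le_efloorE// -prod_wealth_factor.
Qed.

Hypothesis p01 : forall j t, 0 <= p j t <= 1.
Hypothesis indep : mutually_independent H0 p.
Hypothesis mg : measurable_fun setT g.
Hypothesis null_expectation : forall i, i \in H0 ->
  (\int[P]_t (expR (L * (p i t <= pstar)%R%:R) * g (p i t))%:E <= 1)%E.

Lemma wealth_factor_ge0 i u : 0 <= wealth_factor i u.
Proof.
have /andP[g0 _] := g01 u; rewrite mulr_ge0//.
by case: ifP; rewrite ?expR_ge0.
Qed.

Lemma measurable_wealth_factor i : measurable_fun setT (wealth_factor i).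
Proof.
rewrite /wealth_factor; case: (i \in H0); apply: measurable_funM => //.
apply: measurableT_comp => //.
apply: measurable_funM; first exact: measurable_cst.
rewrite (_ : (fun u => _) = \1_(`]-oo, pstar]%classic)).
  by apply: measurable_indic; exact: measurable_itv.
by apply/funext => u; rewrite indicE mem_setE.
Qed.

Let nulls : seq 'I_n := [seq pi j | j <- enum 'I_n & pi j \in H0].

(** The non-null factors are at most 1, so dropping them can only increase the
    product; what remains is a prefix product over the nulls. *)
Lemma prod_wealth_factor_le (x : 'I_n -> R) (k : 'I_n) :
  \prod_(j < n | (j <= k)%N) wealth_factor (pi j) (x (pi j)) <=
  running_max [seq wealth_factor i (x i) | i <- nulls].
Proof.
rewrite -map_comp/=.
apply: le_trans (@prod_prefix_le_running_max _ _ (fun j => pi j \in H0)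
  (fun j => wealth_factor (pi j) (x (pi j))) _ k.+1 _); last first.
  by move=> j; exact: wealth_factor_ge0.
rewrite take_enum_ord big_filter_cond big_enum_cond/=.
rewrite [leRHS]big_mkcondr/=; apply: ler_prod => j _.
rewrite wealth_factor_ge0/=; case: ifPn => // Hj.
by rewrite /wealth_factor (negbTE Hj) mul1r; case/andP: (g01 (x (pi j))).
Qed.

(** Where the bound fails, the running maximum of the null factors exceeds
    1 / alpha, which Ville's inequality allows with probability at most
    alpha. *)
Theorem simultaneous_bound_prob :
  (P [set t | simultaneous_bound H0 pi pstar V (fun j => p j t)] >=
   (1 - alpha)%:E)%E.
Proof.
have /andP[al0 al1] := alpha01.
set G := [set t | _].
have GE : G = \bigcap_(k : 'I_n) [set t |
    \prod_(j < n | (j <= k)%N) wealth_factor (pi j) (p (pi j) t) <= 1 / alpha].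
  apply/seteqP; split => t /=.
    by move=> /simultaneous_boundE H k _; exact: H.
  by move=> H; apply/simultaneous_boundE => // k; exact: H.
have mf i : measurable_fun setT (fun t => wealth_factor i (p i t)).
  by apply: measurableT_comp; [exact: measurable_wealth_factor|].
have mG : measurable G.
  rewrite GE; apply: fin_bigcap_measurable; first exact: finite_finset.
  move=> k _; rewrite -[X in measurable X]setTI -preimage_itvNyc.
  have : measurable_fun setT (fun t => \prod_(j < n | (j <= k)%N)
      wealth_factor (pi j) (p (pi j) t)).
    rewrite (_ : (fun t => _) = (fun t =>
      \prod_(j <- [seq j : 'I_n <- enum 'I_n | (j <= k)%N])
        wealth_factor (pi j) (p (pi j) t))).
      by apply: measurable_prod.
    by apply/funext => t; rewrite big_filter big_enum_cond.
  by apply => //; exact: measurable_itv.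
have PC : (P (~` G) <= alpha%:E)%E.
  have uniq_nulls : uniq nulls.
    rewrite map_inj_uniq; last exact: perm_inj.
    by rewrite filter_uniq ?enum_uniq.
  have nullsH : {subset nulls <= H0}.
    by move=> i /mapP[j]; rewrite mem_filter => /andP[Hj _] ->.
  have c0 : 0 < 1 / alpha by rewrite divr_gt0.
  have fE i : i \in nulls -> (\int[P]_t (wealth_factor i (p i t))%:E <= 1)%E.
    by move=> /nullsH Hi; rewrite /wealth_factor Hi; exact: null_expectation.
  have := ville indep uniq_nulls nullsH measurable_wealth_factor
    wealth_factor_ge0 fE c0.
  rewrite div1r invrK; apply: le_trans.
  apply: le_measure; rewrite ?inE//; first exact: measurableC.
    by apply: measurable_gt; apply: measurable_running_max.
  move=> t /= nG; rewrite ltNge; apply/negP => H; apply: nG.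
  apply/simultaneous_boundE => // k.
  by rewrite div1r; exact: le_trans (prod_wealth_factor_le _ _) H.
rewrite -[G]setCK probability_setC; last exact: measurableC.
by rewrite EFinB leeB.
Qed.

End Control.

(** * Accumulation functions *)

Lemma nondecreasing_emeasurable (R : realType) (h : R -> \bar R) :
  {homo h : x y / (x <= y)%R >-> (x <= y)%E} -> measurable_fun setT h.
Proof.
move=> h_nd.
apply: (measurability (@ErealGenCInfty.G R)) => [|/= _ [_] [r] -> <-].
  exact: ErealGenCInfty.measurableE.
apply: measurableI => //; apply: is_interval_measurable => s t/=.
rewrite !in_itv/= !andbT => hs ht u /andP[su ut].
by rewrite in_itv/= andbT (le_trans hs)// h_nd.
Qed.

Lemma integral_unit_interval_ge (R : realType) (f : R -> \bar R) (c : \bar R)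
    (u v : R) :
  measurable_fun setT f -> (forall x, 0 <= f x)%E ->
  0 <= u -> u <= v -> v <= 1 -> (0 <= c)%E ->
  (forall x, u <= x <= v -> (c <= f x)%E) ->
  (c * (v - u)%:E <= \int[lebesgue_measure]_(x in `[0%R, 1%R]) f x)%E.
Proof.
move=> mf f0 u0 uv v1 c0 cf.
apply: (@le_trans _ _ (\int[lebesgue_measure]_(x in `[u, v]) f x)%E);
  last first.
  apply: ge0_subset_integral => //; first exact: measurable_funTS.
  by apply: subset_itv; rewrite bnd_simp.
apply: (@le_trans _ _ (\int[lebesgue_measure]_(x in `[u, v]) c)%E).
  rewrite integral_cst//= lebesgue_measure_itv/= lte_fin EFinB.
  case: ltP => // vu; have -> : v = u by apply/eqP; rewrite eq_le vu.
  by rewrite subee// mule0.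
apply: ge0_le_integral => //; first exact: measurable_funTS.
Qed.

(** An accumulation function is constrained on [0, 1] only; composed with this
    retraction it becomes monotone, hence measurable, on the whole line. *)
Definition clamp (R : realType) (u : R) : R := Num.max 0 (Num.min 1 u).

Lemma clamp01 (R : realType) (u : R) : 0 <= clamp u <= 1.
Proof. by rewrite /clamp le_max lexx ge_max ler01 ge_min lexx. Qed.

Lemma le_clamp (R : realType) (u v : R) : u <= v -> clamp u <= clamp v.
Proof.
move=> uv; rewrite /clamp ge_max !le_max lexx/=; apply/orP.
by right; rewrite le_min !ge_min lexx uv orbT.
Qed.

Lemma clamp_id (R : realType) (u : R) : 0 <= u <= 1 -> clamp u = u.
Proof. by move=> /andP[u0 u1]; rewrite /clamp min_r// max_r. Qed.

Section Discount.
Context (R : realType) (a alpha : R) (h : R -> \bar R).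
Hypothesis a0 : 0 < a.
Hypothesis alpha01 : 0 < alpha < 1.
Hypothesis acc : accumulation h.

Let ha0 : (0 <= (a^-1)%:E)%E. Proof. by rewrite lee_fin invr_ge0 ltW. Qed.

Definition discount (u : R) : R := pow_ereal alpha (h (clamp u) * (a^-1)%:E)%E.

Lemma clamped_ge0 u : (0 <= h (clamp u))%E.
Proof. by apply: accumulation_ge0; rewrite ?clamp01. Qed.

Lemma clamped_nd : {homo (h \o @clamp R) : x y / (x <= y)%R >-> (x <= y)%E}.
Proof.
move=> x y xy /=; have /andP[x0 _] := clamp01 x; have /andP[_ y1] := clamp01 y.
exact: (accumulation_nondecreasing acc x0 (le_clamp xy) y1).
Qed.

Lemma measurable_clamped : measurable_fun setT (h \o @clamp R).
Proof. exact: nondecreasing_emeasurable clamped_nd. Qed.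

Lemma integral_clamped :
  (\int[lebesgue_measure]_(u in `[0%R, 1%R]) h (clamp u) = 1)%E.
Proof.
rewrite -(accumulation_int1 acc); apply: eq_integral => u.
by rewrite inE/= in_itv/= => u01; rewrite clamp_id.
Qed.

Lemma discount_bounds u : 0 <= discount u <= 1.
Proof. by rewrite pow_ereal_ge0 pow_ereal_le1// mule_ge0 ?clamped_ge0. Qed.

Lemma discount_ni : nonincreasing_fun discount.
Proof.
move=> x y xy; apply: pow_ereal_le => //.
  by rewrite mule_ge0 ?clamped_ge0.
by rewrite lee_wpmul2r//; exact: clamped_nd.
Qed.

Lemma measurable_discount : measurable_fun setT discount.
Proof. exact: nonincreasing_measurable measurableT discount_ni. Qed.

Let mD : measurable_fun setT (fun u => (discount u)%:E).
Proof. by apply/measurable_EFinP; exact: measurable_discount. Qed.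

Let J := (\int[lebesgue_measure]_(u in `[0%R, 1%R]) (discount u)%:E)%E.

(** Otherwise h would be infinite on [1/2, 1], and so would be its integral. *)
Lemma clamped_half_fin : (h (clamp 2^-1) < +oo)%E.
Proof.
rewrite ltNge leye_eq; apply/negP => /eqP hy.
have : (+oo * (1 - 2^-1 : R)%:E <= 1)%E.
  apply: (@le_trans _ _ (\int[lebesgue_measure]_(u in `[0%R, 1%R])
    h (clamp u))%E); last by rewrite integral_clamped.
  apply: (integral_unit_interval_ge measurable_clamped) => //.
  - exact: clamped_ge0.
  - by rewrite invf_le1// ler1n.
  - by move=> x /andP[hx _]; rewrite -hy; exact: clamped_nd.
by rewrite gt0_mulye ?leye_eq// lte_fin; lra.
Qed.

Lemma discount_half_gt0 : 0 < discount 2^-1.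
Proof.
rewrite /discount; have := clamped_half_fin; have := clamped_ge0 2^-1.
case: (h _) => [r| |]// _ _ /=.
by rewrite powR_gt0// (alpha_gt0 alpha01).
Qed.

(** The integrand is at least its value at 1/2 over [0, 1/2]. *)
Lemma integral_discount_gt0 : (0 < J)%E.
Proof.
apply: (@lt_le_trans _ _ ((discount 2^-1)%:E * (2^-1 - 0)%:E)%E).
  by rewrite subr0 -EFinM lte_fin mulr_gt0 ?discount_half_gt0.
apply: (integral_unit_interval_ge (f := fun u => (discount u)%:E)) => //.
- by move=> x; rewrite lee_fin; case/andP: (discount_bounds x).
- lra.
- by rewrite lee_fin ltW ?discount_half_gt0.
- by move=> x /andP[_ hx]; rewrite lee_fin; exact: discount_ni.
Qed.

(** Otherwise h would vanish on [0, 1[, and so would its integral. *)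
Lemma exists_clamped_gt0 : exists2 u, 0 <= u < 1 & (0 < h (clamp u))%E.
Proof.
apply/not_exists2P => H; have := integral_clamped.
rewrite -integral_itv_bndo_bndc; last first.
  by apply: measurable_funTS measurable_clamped.
rewrite integral0_eq; first by move=> /eqP; rewrite eqe eq_sym oner_eq0.
move=> u /=; rewrite in_itv/= => u01; apply/eqP.
rewrite eq_le clamped_ge0 andbT leNgt.
by apply/negP => hu; case: (H u).
Qed.

(** Once h is positive at some u < 1, the discount stays below a constant less
    than 1 on [u, 1]; so its complement to 1 has a positive integral. *)
Lemma integral_discount_lt1 : (J < 1)%E.
Proof.
have [u /andP[u0 u1] hu] := exists_clamped_gt0.
have Du : discount u < 1.
  rewrite /discount; move: hu; case: (h _) => [r| |]//=; last first.
    by move=> _; rewrite gt0_mulye ?lte_fin ?invr_gt0.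
  rewrite lte_fin => r0.
  rewrite (powR_alpha alpha01) expR_lt1 pmulr_rlt0 ?divr_gt0//.
  exact: ln_alpha_lt0.
have m1D : measurable_fun setT (fun u => (1 - discount u)%:E).
  apply/measurable_EFinP; apply: measurable_funB; first exact: measurable_cst.
  exact: measurable_discount.
have K0 : (0 < \int[lebesgue_measure]_(u in `[0%R, 1%R]) (1 - discount u)%:E)%E.
  apply: (@lt_le_trans _ _ ((1 - discount u)%:E * (1 - u)%:E)%E).
    by rewrite -EFinM lte_fin mulr_gt0 ?subr_gt0.
  apply: (integral_unit_interval_ge (f := fun u => (1 - discount u)%:E)) => //.
  - by move=> x; rewrite lee_fin subr_ge0; case/andP: (discount_bounds x).
  - exact: ltW.
  - by rewrite lee_fin subr_ge0 ltW.
  - by move=> x /andP[hx _]; rewrite lee_fin lerB// discount_ni.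
have : (J + \int[lebesgue_measure]_(u in `[0%R, 1%R]) (1 - discount u)%:E
        = 1)%E.
  rewrite -ge0_integralD//.
  - rewrite (eq_integral (cst 1%E)); last first.
      by move=> x _; rewrite /= -EFinD subrKC.
    by rewrite integral_cst//= lebesgue_measure_itv/= lte_fin ltr01 mul1e sube0.
  - by move=> x _; rewrite lee_fin; case/andP: (discount_bounds x).
  - exact: measurable_funTS.
  - by move=> x _; rewrite lee_fin subr_ge0; case/andP: (discount_bounds x).
  - exact: measurable_funTS.
have : (0 <= J)%E by exact: ltW integral_discount_gt0.
move: K0; set K := integral _ _ _; case: J K => [j| |] [k| |]//.
rewrite !lte_fin => k0 _ [] jk; lra.
Qed.

Lemma Rintegral_discount :
  (\int[lebesgue_measure]_(u in `[0, 1]) pow_ereal alpha (h u * (a^-1)%:E)%E)%:E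
   = J.
Proof.
rewrite -[RHS]fineK; last first.
  rewrite ge0_fin_numE; last exact: ltW integral_discount_gt0.
  by rewrite (lt_trans integral_discount_lt1)// ltry.
congr (fine _)%:E; apply: eq_integral => u.
by rewrite inE/= in_itv/= => u01; rewrite /discount clamp_id.
Qed.

(** Convexity of the exponential: the value at x is compared with that of the
    chord through the points 0 and B. *)
Lemma powR_chord (B x : R) : 0 < B -> 0 <= x <= B ->
  alpha `^ (x * a^-1) + (1 - alpha `^ (B / a)) / B * x <= 1.
Proof.
move=> B0 /andP[x0 xB].
have t0 : 0 <= x / B by rewrite divr_ge0// ltW.
have t1 : x / B <= 1 by rewrite ler_pdivrMr// mul1r.
have := convex_expR (Itv01 t0 t1) (B / a * ln alpha) 0.
rewrite !convRE/= expR0 !(powR_alpha alpha01) /unstable.onem => H.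
have -> : x * a^-1 * ln alpha = x / B * (B / a * ln alpha) + (1 - x / B) * 0.
  by field; rewrite !gt_eqF.
rewrite -lerBrDr (le_trans H)//.
set b := expR _; rewrite le_eqVlt; apply/orP; left; apply/eqP; field.
by rewrite gt_eqF.
Qed.

Section Bounded.
Variable B : R.
Hypothesis hB : forall u, 0 <= u <= 1 -> (h u <= B%:E)%E.

(** The integral of h is 1 over an interval of length 1. *)
Lemma bound_ge1 : 1 <= B.
Proof.
have : (\int[lebesgue_measure]_(u in `[0%R, 1%R]) h (clamp u) <=
        \int[lebesgue_measure]_(u in `[0%R, 1%R]) (cst B%:E u))%E.
  apply: ge0_le_integral => //.
  - by move=> u _; exact: clamped_ge0.
  - exact: measurable_funTS measurable_clamped.
  - by move=> u _; apply: hB; exact: clamp01.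
rewrite integral_clamped integral_cst//= lebesgue_measure_itv/= lte_fin ltr01.
by rewrite sube0 mule1 lee_fin.
Qed.

(** Integrate the chord inequality: the linear term integrates to its slope
    because h has integral 1. *)
Lemma integral_discount_le_chord : (J <= (1 - (1 - alpha `^ (B / a)) / B)%:E)%E.
Proof.
have B1 := bound_ge1; have B0 : 0 < B by apply: lt_le_trans B1.
set kappa := (1 - alpha `^ (B / a)) / B.
have k0 : 0 <= kappa.
  rewrite divr_ge0 ?(ltW B0)// subr_ge0 (powR_alpha alpha01) expR_le1.
  by rewrite pmulr_rle0 ?divr_gt0// ltW// ln_alpha_lt0.
suff : (J + kappa%:E <= 1)%E.
  by rewrite EFinB leeBrDr.
have -> : (kappa%:E =
    \int[lebesgue_measure]_(u in `[0%R, 1%R]) (kappa%:E * h (clamp u)))%E.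
  rewrite ge0_integralZl// ?integral_clamped ?mule1//.
  - exact: measurable_funTS measurable_clamped.
  - by move=> u _; exact: clamped_ge0.
rewrite -ge0_integralD//; last 4 first.
- by move=> x _; rewrite lee_fin; case/andP: (discount_bounds x).
- exact: measurable_funTS.
- by move=> x _; rewrite mule_ge0 ?clamped_ge0.
- apply: measurable_funTS; apply: measurable_funeM.
  exact: measurable_clamped.
apply: (@le_trans _ _
    (\int[lebesgue_measure]_(u in `[0%R, 1%R]) (cst (1 : R)%:E u))%E);
  last first.
  by rewrite integral_cst//= lebesgue_measure_itv/= lte_fin ltr01 mul1e sube0.
apply: ge0_le_integral => //.
- move=> x _; rewrite adde_ge0 ?mule_ge0 ?clamped_ge0//.
  by rewrite lee_fin; case/andP: (discount_bounds x).
- apply: measurable_funTS; apply: emeasurable_funD => //.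
  by apply: measurable_funeM; exact: measurable_clamped.
move=> u _; have := hB (clamp01 u); have := clamped_ge0 u; rewrite /discount.
case: (h _) => [r| |]//; rewrite !lee_fin => r0 rB.
by apply: powR_chord => //; rewrite r0.
Qed.

End Bounded.

(** The constant c is the integral of the discount itself for a general h, and
    its chord bound for a bounded h. *)
Lemma preorder_acc_prob (d : measure_display) (T : measurableType d)
    (P : probability T R) (n : nat) (H0 : {set 'I_n}) (pi : 'S_n)
    (p : 'I_n -> {RV P >-> R}) (c : R) :
  (forall j t, 0 <= p j t <= 1) ->
  mutually_independent H0 p ->
  (forall j, j \in H0 -> stochastically_larger_than_uniform (p j)) ->
  0 < c < 1 -> (J <= c%:E)%E ->
  (P [set t | simultaneous_bound H0 pi 1
    (fun x k => efloor ((ln (1 / alpha) / (a * ln (c^-1)))%:E *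
          (a%:E + \sum_(j < n | (j <= k)%N) h (x (pi j))))%E)
    (fun j => p j t)] >= (1 - alpha)%:E)%E.
Proof.
move=> p01 indep pU /andP[c0 c1] Jc.
have L0 : 0 < ln (c^-1) by rewrite ln_gt0// invf_gt1.
apply: (simultaneous_bound_prob (h := h) a0 alpha01 L0 _ _ discount_bounds _ p01
  indep measurable_discount) => //.
- exact: accumulation_ge0.
- by move=> u u01; rewrite /discount clamp_id.
move=> i Hi.
have -> :
    (\int[P]_t (expR (ln c^-1 * (p i t <= 1)%R%:R) * discount (p i t))%:E =
    (c^-1)%:E * \int[P]_t (discount (p i t))%:E)%E.
  rewrite -ge0_integralZl//.
  - apply: eq_integral => t _; have /andP[_ ->] := p01 i t.
    by rewrite mulr1 lnK ?posrE ?invr_gt0// EFinM.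
  - apply/measurable_EFinP; apply: measurableT_comp => //.
    exact: measurable_discount.
  - by move=> t _; rewrite lee_fin; case/andP: (discount_bounds (p i t)).
  - by rewrite lee_fin invr_ge0 ltW.
rewrite lee_pdivrMl// mule1; apply: le_trans Jc.
apply: le_expectation_uniform => //; first exact: pU.
  by move=> x; case/andP: (discount_bounds x).
exact: discount_ni.
Qed.

End Discount.

(** * Selection below a threshold *)

Section Selection.
Context (R : realType) (a alpha pstar lambda : R).
Hypothesis a0 : 0 < a.
Hypothesis alpha01 : 0 < alpha < 1.
Hypothesis pstar01 : 0 < pstar < 1.
Hypothesis lambda_itv : pstar <= lambda < 1.

Let B := pstar / (1 - lambda).
Let b := alpha `^ (B / a).
Let kappa := (1 - b) / B.

Let B0 : 0 < B.
Proof.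
case/andP: pstar01 => ? _; case/andP: lambda_itv => _ ?.
by rewrite divr_gt0// subr_gt0.
Qed.

Let b01 : 0 < b < 1.
Proof.
have Ba0 : 0 < B / a by exact: divr_gt0.
rewrite /b (powR_alpha alpha01) expR_gt0 expR_lt1 pmulr_rlt0//=.
exact: ln_alpha_lt0.
Qed.

Let kappa0 : 0 < kappa.
Proof. by case/andP: b01 => _ b1; rewrite divr_gt0// subr_gt0. Qed.

(** This is alpha ^ (h u / a) for the score h u = B I(u > lambda). *)
Definition sel_discount (u : R) : R := if u <= lambda then 1 else b.

Lemma sel_discount_ni : nonincreasing_fun sel_discount.
Proof.
case/andP: b01 => bp b1 x y xy; rewrite /sel_discount.
case: (leP y) => yl; case: (leP x) => xl//; last exact: ltW.
by have := lt_le_trans xl (le_trans xy yl); rewrite ltxx.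
Qed.

(** The factor is 1 + kappa up to pstar, then 1 up to lambda, then b; as a
    decreasing step function it is a constant plus nonnegative multiples of
    indicators of half-lines, to which stochastic dominance applies. *)
Lemma sel_wealthE (u : R) :
  expR (ln (1 + kappa) * (u <= pstar)%R%:R) * sel_discount u =
  b + (1 - b) * \1_(`]-oo, lambda]) u + kappa * \1_(`]-oo, pstar]) u.
Proof.
case/andP: lambda_itv => pl _.
rewrite !indicE !mem_setE !in_itv/= /sel_discount.
case: (leP u pstar) => up.
  by rewrite (le_trans up pl) !mulr1 lnK ?posrE ?addr_gt0//; ring.
by rewrite mulr0 expR0; case: (leP u lambda) => _ /=; ring.
Qed.

(** Since kappa pstar = (1 - b) (1 - lambda), the bounds on the three terms add
    up to b + (1 - b) lambda + (1 - b) (1 - lambda) = 1. *)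
Lemma integral_sel_wealth (d : measure_display) (T : measurableType d)
    (P : probability T R) (X : {RV P >-> R}) :
  stochastically_larger_than_uniform X ->
  (\int[P]_t (expR (ln (1 + kappa) * (X t <= pstar)%R%:R) *
              sel_discount (X t))%:E <= 1)%E.
Proof.
move=> sX; case/andP: b01 => bp b1; case/andP: lambda_itv => pl l1.
case/andP: pstar01 => ps0 ps1.
have m1 (s : R) : measurable_fun setT (fun t => \1_(`]-oo, s]) (X t) : R).
  by apply: (@measurableT_comp _ _ _ _ _ _ (\1_(`]-oo, s]) : R -> R)) => //.
have mI (c s : R) :
    measurable_fun setT (fun t => (c * \1_(`]-oo, s]) (X t))%:E).
  by apply/measurable_EFinP; apply: measurable_funM.
have I0 (c s : R) t : 0 <= c -> (0 <= (c * \1_(`]-oo, s]) (X t))%:E)%E.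
  by move=> c0; rewrite lee_fin mulr_ge0// indicE.
have EI (c s : R) : 0 <= c -> 0 <= s <= 1 ->
    (\int[P]_t (c * \1_(`]-oo, s]) (X t))%:E <= (c * s)%:E)%E.
  move=> c0 s01; under eq_integral do rewrite EFinM.
  rewrite ge0_integralZl//; last exact/measurable_EFinP.
  rewrite EFinM lee_wpmul2l//; apply: le_trans (sX _ s01).
  have mXs : measurable (X @^-1` `]-oo, s]) by exact: measurable_funPTI.
  rewrite (_ : [set t | _] = X @^-1` `]-oo, s] `&` setT).
    by rewrite -integral_indic.
  by rewrite setIT preimage_itvNyc.
under eq_integral do rewrite sel_wealthE EFinD EFinD.
rewrite ge0_integralD//; last 3 first.
- by move=> t _; rewrite adde_ge0 ?I0 ?lee_fin ?ltW ?subr_gt0.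
- by apply: emeasurable_funD => //; exact: mI.
- by move=> t _; apply: I0; exact: ltW.
rewrite ge0_integralD//; last 2 first.
- by move=> t _; rewrite lee_fin ltW.
- by move=> t _; apply: I0; rewrite subr_ge0 ltW.
rewrite integral_cst//= probability_setT mule1.
have E1 := EI kappa pstar (ltW kappa0); have E2 := EI (1 - b) lambda.
have lambda01 : 0 <= lambda <= 1 by rewrite (le_trans (ltW ps0) pl) ltW.
have ps01 : 0 <= pstar <= 1 by rewrite !ltW.
apply: le_trans (leeD (leeD (lexx _) (E2 _ lambda01)) (E1 ps01)) _.
  by rewrite subr_ge0 ltW.
rewrite -!EFinD lee_fin (_ : kappa * pstar = (1 - b) * (1 - lambda)).
  by rewrite le_eqVlt; apply/orP; left; apply/eqP; ring.
rewrite /kappa /B; field.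
by rewrite !gt_eqF ?subr_gt0.
Qed.

Lemma preorder_sel_prob (d : measure_display) (T : measurableType d)
    (P : probability T R) (n : nat) (H0 : {set 'I_n}) (pi : 'S_n)
    (p : 'I_n -> {RV P >-> R}) :
  (forall j t, 0 <= p j t <= 1) ->
  mutually_independent H0 p ->
  (forall j, j \in H0 -> stochastically_larger_than_uniform (p j)) ->
  (P [set t | simultaneous_bound H0 pi pstar
                (V_preorder_sel a alpha pstar lambda pi)
                (fun j => p j t)] >= (1 - alpha)%:E)%E.
Proof.
move=> p01 indep pU; case/andP: b01 => bp b1.
have L0 : 0 < ln (1 + kappa) by rewrite ln_gt0// ltrDl.
apply: (simultaneous_bound_prob (h := fun u => (B * (lambda < u)%R%:R)%:E)
  (g := sel_discount) a0 alpha01 L0 _ _ _ _ p01 indep).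
- by move=> u _; rewrite lee_fin mulr_ge0 ?(ltW B0).
- move=> u _; rewrite /sel_discount -EFinM /=; case: leP => _.
    by rewrite mulr0 mul0r powRr0.
  by rewrite mulr1.
- move=> u; rewrite /sel_discount; case: ifP => _; rewrite ?ler01 ?lexx//.
  by rewrite (ltW bp) ltW.
- by move=> x k _; rewrite sumEFin -EFinD -EFinM.
- exact: nonincreasing_measurable measurableT sel_discount_ni.
- by move=> i Hi; apply: integral_sel_wealth; exact: pU.
Qed.

End Selection.

Theorem theorem2 (d : measure_display) (T : measurableType d) (R : realType)
    (P : probability T R) (n : nat) (H0 : {set 'I_n}) (pi : 'S_n)
    (p : 'I_n -> {RV P >-> R}) (a : R) :
  0 < a ->
  (forall j t, 0 <= p j t <= 1) ->
  mutually_independent H0 p ->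
  (forall j, j \in H0 -> stochastically_larger_than_uniform (p j)) ->
  (forall h : R -> \bar R, accumulation h ->
    (forall alpha : R, 0 < alpha < 1 ->
      (P [set t | simultaneous_bound H0 pi 1 (V_preorder_acc a alpha pi h)
                    (fun j => p j t)] >= (1 - alpha)%:E)%E) /\
    (forall B : R, ereal_sup (h @` `[0, 1]) = B%:E ->
     forall alpha : R, 0 < alpha < 1 ->
      (P [set t | simultaneous_bound H0 pi 1
                    (V_preorder_acc_bounded a alpha B pi h)
                    (fun j => p j t)] >= (1 - alpha)%:E)%E)) /\
  (forall pstar lambda : R, 0 < pstar < 1 -> pstar <= lambda < 1 ->
    forall alpha : R, 0 < alpha < 1 ->
      (P [set t | simultaneous_bound H0 pi pstar
                    (V_preorder_sel a alpha pstar lambda pi)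
                    (fun j => p j t)] >= (1 - alpha)%:E)%E).
Proof.
move=> a0 p01 indep pU; split; last first.
  by move=> pstar lambda ps01 lam alpha alpha01; exact: preorder_sel_prob.
move=> h acc; split=> [alpha alpha01|B hB alpha alpha01].
  rewrite /V_preorder_acc.
  apply: preorder_acc_prob => //; last first.
    by rewrite (Rintegral_discount a0 alpha01 acc).
  rewrite -!lte_fin (Rintegral_discount a0 alpha01 acc).
  by rewrite integral_discount_gt0 ?integral_discount_lt1.
have hle u : 0 <= u <= 1 -> (h u <= B%:E)%E.
  move=> u01; rewrite -hB; apply: ereal_sup_ubound.
  by exists u; rewrite //= in_itv.
have B0 : 0 < B by exact: lt_le_trans (bound_ge1 acc hle).
rewrite /V_preorder_acc_bounded.
have J0 := integral_discount_gt0 a0 alpha01 acc.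
have JB := integral_discount_le_chord a0 alpha01 acc hle.
apply: preorder_acc_prob => //.
rewrite -lte_fin (lt_le_trans J0 JB)/= gtrBl divr_gt0// subr_gt0.
by rewrite (powR_alpha alpha01) expR_lt1 pmulr_rlt0 ?divr_gt0 ?ln_alpha_lt0.
Qed.
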